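(* Let $I(n)$ denote the number of isomorphism classes of subgroups of $(\mathbb{Z}/n\mathbb{Z})^\times$. The order of magnitude of the maximal order of $\log I(n)$ is $\log x/\log\log x$. More precisely, as $x\to\infty$, $$\frac{\log2}{5}\frac{\log x}{\log\log x}+O\bigg(\frac{\log x}{(\log\log x)^2}\bigg)\le\max_{n\le x}\big(\log I(n)\big)\le\pi\sqrt{\frac23}\,\frac{\log x}{\log\log x}+O\bigg(\frac{\log x}{(\log\log x)^2}\bigg).$$
   Context: The maximum is over positive integers $n\le x$; the implied constants are absolute and the estimates are for $x$ sufficiently large. *)

(* Defs.v *)
From mathcomp Require Import all_boot all_order all_fingroup all_algebra.
From mathcomp Require Import all_classical all_reals all_analysis.
Import Order.TTheory GRing.Theory Num.Theory numFieldNormedType.Exports.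

Set Implicit Arguments.
Unset Strict Implicit.
Unset Printing Implicit Defensive.

Local Open Scope ring_scope.

(* 'Z_1 is the ring Z/2Z, whose unit group is trivial, as (Z/1Z)^* is: hence  *)
(* units_Zp n is isomorphic to (Z/nZ)^* for every n >= 1.                     *)
Definition num_iso_subgroups (n : nat) : nat :=
  #|equivalence_partition
      (fun H K : {group {unit 'Z_n}} => H \isog K) (subgroups (units_Zp n))|.

(* The default value 0 of the maximum is immaterial for x >= 1, since         *)
(* num_iso_subgroups n >= 1 (the trivial subgroup) makes all logarithms       *)
(* nonnegative.                                                               *)
Definition max_log_iso_subgroups (R : realType) (x : R) : R :=
  \big[Num.max/0]_(1 <= n < (Num.truncn x).+1) ln (num_iso_subgroups n)%:R.

(* Main.v *)
Require Import Defs.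
From mathcomp Require Import all_boot all_order all_fingroup all_algebra.
From mathcomp Require Import all_solvable zify ring lra.
From mathcomp Require Import all_classical all_reals all_analysis.
Import Order.TTheory GRing.Theory Num.Theory numFieldNormedType.Exports.

Local Open Scope classical_set_scope.
Local Open Scope ring_scope.

(** Write [I n] for the number of isomorphism classes of subgroups of the unit
    group of Z/nZ, [L = ln x] and [l = ln L].  Both bounds hold for large [x]
    without any error term, because elementary arguments give constants on the
    right side of [ln 2 / 5] and of [pi * sqrt (2 / 3)]; the two error
    functions of the theorem are therefore taken to be zero.

    Lower bound.  An abelian group of order [N] has a subgroup of every order
    that is a product of distinct prime divisors of [N], and groups of
    different orders are not isomorphic, so it has at least [2 ^ w] classes of
    subgroups, [w] being the number of primes dividing [N]
    ([exp2_primes_leq_iso_classes]).  If [n = N ^ 2], every prime factor of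
    [N] divides [totient n].  Taking for [N] the central binomial coefficient
    ['C(2 * m, m)], all of whose prime powers are at most [2 * m], gives
    [w >= m * ln 2 / ln (2 * m)] while [n <= 16 ^ m]; with [m] close to
    [L / (4 * ln 2)] this yields [ln (I n) >= (ln 2 / 4 - o(1)) * L / l].

    Upper bound.  A subgroup [H] of an abelian group [G] is determined up to
    isomorphism by the number [a(p, k)] of cyclic factors of order [p ^ k] in
    its primary decomposition, and the product of all [p ^ (k * a(p, k))] is
    [#|H| <= #|G|].  Counting such families with the weight
    [(#|G| / #|H|) ^ s >= 1] (Rankin's trick) turns the count into an Euler
    product, so that [ln (I n)] is at most
    [s * ln #|G| + \sum_(p | #|G|) p^-s / (1 - p^-s) ^ 2]
    ([ln_iso_classes_leq]).  Take [s = (16 / 9) / l] and split the sum at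
    [z = L ^ (9 / 10)].  A prime above [z] contributes at most [4 / 9], and
    there are at most [L / ln z] of them; the primes below [z] contribute
    [O(z * l ^ 2)] in total.  This gives
    [ln (I n) <= (16 / 9 + 40 / 81 + o(1)) * L / l], and
    [16 / 9 + 40 / 81 < 12 / 5 <= pi * sqrt (2 / 3)] since [pi >= 3]. *)

(** * Counting the classes of an equivalence relation *)

Lemma leq_card_equivalence_partition (T I : finType) (r : rel T) (D : {set T})
    (A : {set I}) (f : I -> T) :
  {in D & &, equivalence_rel r} -> {in A, forall i, f i \in D} ->
  {in A &, forall i j, r (f i) (f j) -> i = j} ->
  (#|A| <= #|equivalence_partition r D|)%N.
Proof.
move=> eqr AD rinj; pose g i := [set y in D | r (f i) y]%SET.
have ginj : {in A &, injective g}.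
  move=> i j Ai Aj /setP/(_ (f j)); rewrite !inE (AD j Aj) /=.
  by have [-> _] := eqr _ _ _ (AD j Aj) (AD j Aj) (AD j Aj) => /(rinj _ _ Ai Aj).
rewrite -(card_in_imset ginj); apply/subset_leq_card/fintype.subsetP.
by move=> _ /imsetP[i Ai ->]; apply/imsetP; exists (f i); rewrite ?AD.
Qed.

Lemma card_equivalence_partition_leq (T I : finType) (r : rel T) (D : {set T})
    (B : {set I}) (f : T -> I) :
  {in D & &, equivalence_rel r} -> {in D, forall x, f x \in B} ->
  {in D &, forall x y, f x = f y -> r x y} ->
  (#|equivalence_partition r D| <= #|B|)%N.
Proof.
move=> eqr DB fr.
pose g i := [set y in D | [exists x in D, (f x == i) && r x y]]%SET.
apply: leq_trans (leq_imset_card g _); apply/subset_leq_card/fintype.subsetP.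
move=> _ /imsetP[x Dx ->]; apply/imsetP; exists (f x); first exact: DB.
apply/setP=> y; rewrite !inE; apply: andb_id2l => Dy.
apply/idP/existsP => [rxy|[z /and3P[Dz /eqP fzx rzy]]].
  by exists x; rewrite Dx eqxx.
by have [_ <-] := eqr z x y Dz Dx Dy; last exact: fr.
Qed.

Lemma isog_equivalence_rel (gT : finGroupType) (D : {set {group gT}}) :
  {in D & &, equivalence_rel (fun H K : {group gT} => H \isog K)}.
Proof.
move=> H K L _ _ _; split; first exact: isog_refl.
move=> HK; apply/idP/idP => [|/(isog_trans HK)//].
by apply/isog_trans; rewrite isog_sym.
Qed.

(** * Many subgroups of distinct orders *)

(** Cauchy gives a cyclic subgroup of each prime order; as these have coprime
    orders and commute, their product is direct. *)
Lemma abelian_subgroup_of_prime_product (gT : finGroupType) (G : {group gT})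
    (s : seq nat) :
  abelian G -> uniq s -> {in s, forall p, prime p /\ (p %| #|G|)%N} ->
  exists2 H : {group gT}, H \subset G & #|H| = (\prod_(p <- s) p)%N.
Proof.
move=> abG; elim: s => [_ _|p s IHs /= /andP[ps us] sP].
  by exists 1%G; rewrite ?sub1G ?cards1 ?big_nil.
have [p_pr pG] := sP p (mem_head _ _).
have [x Gx ox] := Cauchy p_pr pG.
have [|H sHG oH] := IHs us; first by move=> q qs; apply: sP; rewrite inE qs orbT.
have sxG : <[x]>%g \subset G by rewrite cycle_subG.
have cxH : (<[x]> \subset 'C(H))%g by apply: sub_abelian_cent2 sxG sHG.
exists (<[x]> <*> H)%G; first by rewrite join_subG sxG.
rewrite /= cent_joinEl // coprime_cardMg -?orderE ?ox ?oH ?big_cons //.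
rewrite prime_coprime // Euclid_dvd_prod // big_has_cond; apply/hasPn => q qs /=.
have [q_pr _] := sP q (@mem_behead _ (p :: s) q qs).
by rewrite dvdn_prime2 //; apply: contraNneq ps => ->.
Qed.

(** A set of prime divisors can be read off the order of a subgroup whose order
    is their product, so different sets give non-isomorphic subgroups. *)
Lemma exp2_primes_leq_iso_classes (gT : finGroupType) (G : {group gT}) :
  abelian G ->
  (2 ^ size (primes #|G|) <=
   #|equivalence_partition (fun H K : {group gT} => H \isog K) (subgroups G)|)%N.
Proof.
move=> abG; set s := primes _.
pose sP (i : 'I_(size s)) := tnth (in_tuple s) i.
have sPs i : sP i \in s by exact: mem_tnth.
have sPp i : prime (sP i) by have := sPs i; rewrite mem_primes => /and3P[].
have sPi : injective sP by move=> i j /(tuple_uniqP (in_tuple s) (primes_uniq _)).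
pose o (S : {set 'I_(size s)}) := (\prod_(i in S) sP i)%N.
have Hex S : exists H : {group gT}, (H \subset G) && (#|H| == o S).
  have [||H sHG oH] := @abelian_subgroup_of_prime_product _ G
      [seq sP i | i <- enum S] abG.
  - by rewrite map_inj_uniq ?enum_uniq.
  - move=> p /mapP[i _ ->]; split=> //.
    by have := sPs i; rewrite mem_primes => /and3P[].
  by exists H; rewrite sHG oH big_map big_enum /=.
have oP (S : {set 'I_(size s)}) i : (i \in S) = (sP i %| o S)%N.
  apply/idP/idP => [iS|]; first by rewrite /o (bigD1 i) //= dvdn_mulr.
  rewrite Euclid_dvd_prod // big_has_cond => /hasP[j _ /andP[jS]].
  by rewrite dvdn_prime2 // => /eqP/sPi ->.
have -> : (2 ^ size s)%N = #|[set: {set 'I_(size s)}]%SET|.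
  by rewrite -powersetT card_powerset cardsT card_ord.
apply: (@leq_card_equivalence_partition _ _ _ _ _ (fun S => xchoose (Hex S))).
- exact: isog_equivalence_rel.
- by move=> S _; rewrite inE; have /andP[] := xchooseP (Hex S).
- move=> S S' _ _ /card_isog.
  have /andP[_ /eqP ->] := xchooseP (Hex S).
  have /andP[_ /eqP ->] := xchooseP (Hex S').
  by move=> oSS'; apply/setP => i; rewrite !oP oSS'.
Qed.

(** Squaring [N] is what makes each prime factor of [N] divide the order of the
    unit group: [totient (p ^ e)] is a multiple of [p] once [e >= 2]. *)
Lemma exp2_primes_leq_num_iso_subgroups_sqr (N : nat) :
  (0 < N)%N -> (2 ^ size (primes N) <= num_iso_subgroups (N ^ 2))%N.
Proof.
move=> N0; have N20 : (0 < N ^ 2)%N by rewrite expn_gt0 N0.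
apply: leq_trans (exp2_primes_leq_iso_classes _ _ (units_Zp_abelian _)).
rewrite leq_exp2l // card_units_Zp // uniq_leq_size ?primes_uniq // => p.
rewrite !mem_primes => /and3P[p_pr _ pN]; rewrite p_pr totient_gt0 N20 /=.
rewrite totientE // (bigD1_seq p) ?primes_uniq //=; last first.
  by rewrite mem_primes p_pr N20 Euclid_dvdX // pN.
rewrite -mulnA dvdn_mull // dvdn_mulr // -{1}(expn1 p) dvdn_exp2l // lognX.
by have : (0 < logn p N)%N by [rewrite logn_gt0 mem_primes p_pr N0]; lia.
Qed.

(** * Central binomial coefficients have many prime factors *)

(** By Legendre, the exponent of [p] is the sum over [k] of
    [2 * m %/ p ^ k - 2 * (m %/ p ^ k)]; each term is 0 or 1, and it vanishes
    when [p ^ k > 2 * m]. *)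
Lemma pfactor_central_bin_leq (p m : nat) :
  prime p -> (0 < m)%N -> (p ^ logn p 'C(2 * m, m) <= 2 * m)%N.
Proof.
move=> p_pr m0; have p1 := prime_gt1 p_pr; have m20 : (0 < 2 * m)%N by lia.
apply: leq_trans (trunc_logP p1 m20); rewrite leq_exp2l //.
set e := trunc_log p _.
have e2m : (e <= 2 * m)%N.
  by rewrite ltnW // (leq_trans (ltn_expl e p1)) // trunc_logP.
have trunc0 k : (e < k)%N -> (2 * m %/ p ^ k = 0)%N.
  move=> ek; rewrite divn_small // (leq_trans (trunc_log_ltn _ p1)) //.
  by rewrite leq_exp2l.
have lognE q : (q <= 2 * m)%N -> logn p q`! = (\sum_(1 <= k < e.+1) q %/ p ^ k)%N.
  move=> q2m; rewrite logn_fact //.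
  have sumE r : (r >= q)%N -> (\sum_(1 <= k < q.+1) q %/ p ^ k =
      \sum_(1 <= k < r.+1) q %/ p ^ k)%N.
    move=> qr; rewrite [RHS](@big_cat_nat _ _ _ q.+1) //=.
    rewrite [X in (_ + X)%N]big_nat_cond [X in (_ + X)%N]big1 ?addn0 //.
    move=> k; rewrite andbT => /andP[qk _]; rewrite divn_small //.
    by rewrite (leq_trans qk) // ltnW // ltn_expl.
  rewrite (sumE (2 * m)%N) // (@big_cat_nat _ _ _ e.+1) //=.
  rewrite [X in (_ + X)%N]big_nat_cond [X in (_ + X)%N]big1 ?addn0 //.
  move=> k; rewrite andbT => /andP[ek _].
  apply/eqP; rewrite -leqn0 -(trunc0 k) //.
  by rewrite leq_div2r.
have := congr1 (logn p) (@bin_fact (2 * m) m ltac:(lia)).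
have -> : (2 * m - m = m)%N by lia.
rewrite !lognM ?muln_gt0 ?fact_gt0 ?bin_gt0 //; try lia.
rewrite !lognE; try lia.
set A := (\sum_(_ <= _ < _) m %/ _)%N; set B := (\sum_(_ <= _ < _) _ %/ _)%N.
suff : (B <= A + A + e)%N by lia.
have -> : e = (\sum_(1 <= k < e.+1) 1)%N by rewrite sum_nat_const_nat; lia.
rewrite /A /B -!big_split /=; apply: leq_sum => k _.
have q0 : (0 < p ^ k)%N by rewrite expn_gt0 (prime_gt0 p_pr).
rewrite -ltnS ltn_divLR //; have := divn_eq m (p ^ k); have := ltn_pmod m q0.
set a := (m %/ _)%N; set b := (m %% _)%N; set q := (p ^ k)%N.
by move=> bq ->; nia.
Qed.

Lemma central_bin_leq_exp_primes (m : nat) : (0 < m)%N ->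
  ('C(2 * m, m) <= (2 * m) ^ size (primes 'C(2 * m, m)))%N.
Proof.
move=> m0; set N := 'C(_, _); have N0 : (0 < N)%N by rewrite bin_gt0; lia.
have {1}-> : N = (\prod_(p <- primes N) p ^ logn p N)%N.
  by rewrite {1}(prod_prime_decomp N0) prime_decompE big_map.
have : {in primes N, forall p, (p ^ logn p N <= 2 * m)%N}.
  move=> p; rewrite mem_primes => /andP[p_pr _].
  exact: pfactor_central_bin_leq.
elim: (primes N) => [|p s IHs] sP; first by rewrite big_nil.
rewrite big_cons expnS leq_mul ?sP ?mem_head // IHs // => q qs.
by rewrite sP // inE qs orbT.
Qed.

Lemma exp2_leq_central_bin (m : nat) : (2 ^ m <= 'C(2 * m, m))%N.
Proof.
elim: m => [|m IHm] //; rewrite expnS.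
have -> : (2 * m.+1 = (2 * m).+2)%N by lia.
have bin_sym : 'C((2 * m).+1, m) = 'C((2 * m).+1, m.+1).
  by rewrite -bin_sub; [congr 'C(_, _); lia | lia].
rewrite binS bin_sym binS; lia.
Qed.

Lemma central_bin_leq_exp4 (m : nat) : ('C(2 * m, m) <= 4 ^ m)%N.
Proof.
rewrite (_ : 4 = 2 ^ 2)%N // -expnM -[X in (X ^ _)%N]/(1 + 1)%N expnDn.
have mm : (m < (2 * m).+1)%N by lia.
rewrite (bigD1 (Ordinal mm)) //= !exp1n !muln1.
exact: leq_addr.
Qed.

(** * A lower bound for pi *)

Lemma sin_le_id (R : realType) (x : R) : 0 <= x -> sin x <= x.
Proof.
rewrite le_eqVlt => /predU1P[<-|x0]; first by rewrite sin0.
have [|c _] := @MVT R sin cos 0 x x0 (fun y _ => is_derive_sin y).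
  by apply: continuous_subspaceT => y; exact: continuous_sin.
by rewrite sin0 !subr0 => ->; rewrite ler_piMl ?cos_le1 // ltW.
Qed.

(** The duplication formula at [pi / 3] forces [cos (pi / 3) = 1 / 2], which is
    also [sin (pi / 6) <= pi / 6]. *)
Lemma pi_ge3 (R : realType) : 3 <= pi :> R.
Proof.
have pi0 : 0 < pi :> R := pi_gt0 R.
set c : R := cos (pi / 3).
have c0 : 0 < c by apply: cos_gt0_pihalf; apply/andP; split; lra.
have c1 : c ^+ 2 *+ 2 - 1 = - c.
  have -> : c = cos (- (pi / 3)) by rewrite cosN.
  by rewrite cosN -cos_mulr2n -(cosN (pi / 3)) -cosDpi; congr cos; lra.
have {}c1 : c = 1 / 2.
  have : (c + 1) * (c - 1 / 2) = 0 by lra.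
  by move/eqP; rewrite mulf_eq0 => /orP[] /eqP; lra.
have : sin (pi / 6) = c by rewrite -cosBpihalf -cosN /c; congr cos; lra.
have := @sin_le_id R (pi / 6) ltac:(lra); lra.
Qed.

(** * Rankin's bound for weighted sums *)

Lemma geometric_sum_leq (R : realType) (M : nat) (r : R) :
  0 <= r -> r < 1 -> \sum_(a < M) r ^+ a <= (1 - r)^-1.
Proof.
move=> r0 r1; have r1' : 0 < 1 - r by lra.
rewrite -[_^-1]mul1r ler_pdivlMr //.
have := subrX1 r M; have := exprn_ge0 M r0; set S := (\sum_(_ < _) _); lra.
Qed.

Lemma inv1B_le_expR (R : realType) (r : R) :
  r < 1 -> (1 - r)^-1 <= expR (r / (1 - r)).
Proof.
move=> r1; have r1' : 1 - r != 0 by lra.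
have {1}-> : (1 - r)^-1 = 1 + r / (1 - r) by field.
exact: expR_ge1Dx.
Qed.

(** Each counted [f] has weight [expR (s * (W - \sum_i w i * f i)) >= 1]; summing
    these weights over all [f] factors into a product of geometric series, each
    at most [(1 - r)^-1 <= expR (r / (1 - r))]. *)
Lemma card_weighted_sum_leq (R : realType) (I : finType) (M : nat)
    (w : I -> R) (s W : R) :
  0 < s -> (forall i, 0 < w i) ->
  #|[set f : {ffun I -> 'I_M} | \sum_i w i * (f i)%:R <= W]%SET|%:R <=
    expR (s * W + \sum_i expR (- (s * w i)) / (1 - expR (- (s * w i)))).
Proof.
move=> s0 w0; set A := [set _ | _]%SET; pose r i := expR (- (s * w i)).
have r0 i : 0 <= r i by exact: expR_ge0.
have r1 i : r i < 1 by rewrite expR_lt1 oppr_lt0 mulr_gt0.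
apply: (@le_trans _ _ (expR (s * W) * \prod_i \sum_(a < M) r i ^+ a)); last first.
  rewrite expRD ler_pM2l ?expR_gt0 // expR_sum.
  apply: ler_prod => i _; rewrite sumr_ge0 => [/=|a _]; last exact: exprn_ge0.
  exact: le_trans (geometric_sum_leq _ M _ (r0 i) (r1 i))
    (inv1B_le_expR _ _ (r1 i)).
rewrite bigA_distr_bigA -sum1_card natr_sum big_distrr /=.
rewrite [leRHS](bigID (mem A)) /= -[leLHS]addr0; apply: lerD; last first.
  apply: sumr_ge0 => f _; rewrite mulr_ge0 ?expR_ge0 ?prodr_ge0 // => i _.
  exact: exprn_ge0.
apply: ler_sum => f; rewrite inE => fW.
rewrite (_ : \prod_i _ = expR (- (s * \sum_i w i * (f i)%:R))); last first.
  rewrite mulr_sumr -sumrN expR_sum; apply: eq_bigr => i _.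
  by rewrite /r -expRM_natr; congr expR; ring.
by rewrite -expRD -[X in X <= _]expR0 ler_expR -mulrBr mulr_ge0 ?subr_ge0 // ltW.
Qed.

(** * Abelian types and their prime multiplicities *)

(** The zeros of a nonincreasing sequence come last, where they agree with the
    default value of [nth]. *)
Lemma nth_filter_pos_sorted (v : seq nat) (i : nat) :
  sorted geq v -> nth 0%N [seq k <- v | 0 < k]%N i = nth 0%N v i.
Proof.
elim: v i => [|x v IHv] i //= vs; have {}IHv j := IHv j (path_sorted vs).
case: posnP => [x0|_]; last by case: i => //= i; exact: IHv.
have v0 : v = nseq (size v) 0%N.
  apply/all_pred1P/allP => y yv /=; move: vs; rewrite path_sortedE; last first.
    by move=> a b c /= ab ac; exact: leq_trans ac ab.
  by move=> /andP[/allP/(_ y yv)/=]; rewrite x0 leqn0.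
by rewrite IHv x0 v0 nth_nseq if_same; case: i => //= i; rewrite nth_nseq if_same.
Qed.

(** In a chain of divisors the [p]-adic valuations are nonincreasing, so their
    multiset determines them in order. The counts for [k > 0] leave out the
    zero valuations, which are trailing; the terms exceed 1, so the length is
    recovered as well. *)
Lemma divisor_chain_inj (s t : seq nat) :
  sorted [rel m n | n %| m]%N s -> sorted [rel m n | n %| m]%N t ->
  all [pred m | 1 < m]%N s -> all [pred m | 1 < m]%N t ->
  (forall p k, prime p -> (0 < k)%N ->
    count [pred d | logn p d == k] s = count [pred d | logn p d == k] t) ->
  s = t.
Proof.
have geq_tr : transitive geq by move=> a b c /= ab ac; exact: leq_trans ac ab.
have geq_anti : antisymmetric geq.
  by move=> a b /= /andP[ab ba]; apply/eqP; rewrite eqn_leq ab ba.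
have logs_sorted p (u : seq nat) : sorted [rel m n | n %| m]%N u ->
    all [pred m | 1 < m]%N u -> sorted geq [seq logn p d | d <- u].
  case: u => //= x u; elim: u x => //= y u IHu x /andP[yx yu] /and3P[x1 y1 u1].
  by rewrite dvdn_leq_log ?IHu ?y1 //; apply: ltnW.
move=> ss ts s1 t1 st.
have nth_pos (u : seq nat) i : all [pred m | 1 < m]%N u -> (0 < nth 1 u i)%N.
  move=> /allP u1; have [iu|iu] := ltnP i (size u); last by rewrite nth_default.
  by apply: ltnW; apply: u1; exact: mem_nth.
have nth_eq i : nth 1%N s i = nth 1%N t i.
  apply: eqn_from_log; rewrite ?nth_pos // => p.
  have [p_pr|p_npr] := boolP (prime p); last first.
    by rewrite [LHS]lognE [RHS]lognE (negPf p_npr).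
  have nth_logn (u : seq nat) :
      sorted [rel m n | n %| m]%N u -> all [pred m | 1 < m]%N u ->
      logn p (nth 1%N u i) =
        nth 0%N [seq k <- [seq logn p d | d <- u] | 0 < k]%N i.
    move=> su u1; rewrite nth_filter_pos_sorted ?logs_sorted //.
    have [iu|iu] := ltnP i (size u); first by rewrite (nth_map 1%N).
    by rewrite !nth_default ?size_map ?logn1.
  rewrite (nth_logn s) // (nth_logn t) //; congr (nth _ _ _).
  apply: (sorted_eq geq_tr geq_anti); rewrite ?sorted_filter ?logs_sorted //.
  (* For k = 0 both counts are 0, so only positive k matters. *)
  have count_pos (u : seq nat) k :
      count_mem k [seq k <- [seq logn p d | d <- u] | 0 < k]%N =
      ((0 < k) * count [pred d | logn p d == k] u)%N.
    rewrite count_filter count_map; elim: u => [|d u /= ->]; rewrite /= ?muln0 //.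
    rewrite mulnDr -mulnb; congr (_ + _)%N.
    by case: eqP => [->|_] /=; rewrite ?muln0 ?muln1 ?mul1n.
  apply/allP => k _ /=; apply/eqP; rewrite !count_pos.
  by case: posnP => [//|k0]; rewrite st.
have size_le (u v : seq nat) : all [pred m | 1 < m]%N v ->
    (forall i, nth 1%N u i = nth 1%N v i) -> (size v <= size u)%N.
  move=> /allP v1 uv; rewrite leqNgt; apply/negP => uv_lt.
  by have := v1 _ (mem_nth 1%N uv_lt); rewrite /= -uv nth_default.
apply: (@eq_from_nth _ 1%N) => [|i _]; last exact: nth_eq.
by apply/eqP; rewrite eqn_leq !size_le.
Qed.

Lemma prod_pfactor_dvdn (s : seq nat) (d : nat) :
  uniq s -> all prime s -> (\prod_(p <- s) p ^ logn p d %| d)%N.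
Proof.
elim: s => [|p s IHs] /=; first by rewrite big_nil dvd1n.
move=> /andP[ps us] /andP[p_pr sP]; rewrite big_cons Gauss_dvd.
  by rewrite pfactor_dvdnn IHs.
rewrite coprimeXl // prime_coprime // Euclid_dvd_prod // big_has_cond.
apply/hasPn => q qs /=; have q_pr := allP sP q qs.
rewrite Euclid_dvdX // dvdn_prime2 //; apply: contra ps => /andP[/eqP -> _] //.
Qed.

Lemma prod_abelian_type (gT : finGroupType) (G : {group gT}) :
  abelian G -> (\prod_(d <- abelian_type G) d)%N = #|G|.
Proof.
move=> abG; have [b defG <-] := abelian_structure abG.
by rewrite big_map -(bigdprod_card defG).
Qed.

(** * Counting the subgroups of an abelian group *)

Lemma sum_logn_ln_leq (R : realType) (s : seq nat) (d : nat) :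
  (0 < d)%N -> uniq s -> all prime s ->
  \sum_(p <- s) (logn p d)%:R * ln p%:R <= ln d%:R :> R.
Proof.
move=> d0 us sP.
have pos (p : nat) : prime p -> 0 < p%:R :> R by move=> /prime_gt0; rewrite ltr0n.
apply: (@le_trans _ _ (ln (\prod_(p <- s) p ^ logn p d)%N%:R)); last first.
  have dvd := @prod_pfactor_dvdn s d us sP.
  by rewrite ler_ln ?posrE ?ltr0n ?(dvdn_gt0 d0) // ler_nat dvdn_leq.
elim: s sP {us} => [|p s IHs] /=; first by rewrite !big_nil ln1.
move=> /andP[p_pr sP]; rewrite !big_cons natrM lnM ?posrE ?ltr0n.
- by rewrite natrX lnXn ?pos // mulr_natl lerD2l IHs.
- by rewrite expn_gt0 prime_gt0.
- by rewrite big_seq prodn_cond_gt0 // => q /(allP sP) q_pr;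
  rewrite expn_gt0 prime_gt0.
Qed.

Lemma ln_prod_nat (R : realType) (s : seq nat) :
  all (ltn 0) s -> ln (\prod_(d <- s) d)%N%:R = \sum_(d <- s) ln d%:R :> R.
Proof.
elim: s => [|d s IHs] /=; first by rewrite !big_nil ln1.
move=> /andP[d0 s0]; rewrite !big_cons natrM lnM ?posrE ?ltr0n ?IHs //.
by rewrite big_seq prodn_cond_gt0 // => q /(allP s0).
Qed.

(** With [r = expR (- u)], replace every denominator [1 - r ^ k.+1] by [1 - r]
    and sum the geometric series. *)
Lemma sum_expR_geometric_leq (R : realType) (N : nat) (u : R) : 0 < u ->
  \sum_(k < N) expR (- (k.+1%:R * u)) / (1 - expR (- (k.+1%:R * u))) <=
    expR (- u) / (1 - expR (- u)) ^+ 2.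
Proof.
move=> u0; set r := expR (- u).
have r0 : 0 <= r by exact: expR_ge0.
have r1 : r < 1 by rewrite expR_lt1 oppr_lt0.
have rE k : expR (- (k%:R * u)) = r ^+ k by rewrite -mulrN expRM_natl.
apply: (@le_trans _ _ (\sum_(k < N) r / (1 - r) * r ^+ k)).
  apply: ler_sum => k _; rewrite rE exprS mulrAC.
  apply: ler_wpM2r; first exact: exprn_ge0.
  apply: ler_wpM2l => //; rewrite lef_pV2 ?posrE; last 2 first.
  - by rewrite subr_gt0 -exprS exprn_ilt1.
  - by rewrite subr_gt0.
  by rewrite lerD2l lerN2 ler_piMr // exprn_ile1 // ltW.
rewrite -mulr_sumr expr2 invfM mulrA ler_wpM2l ?geometric_sum_leq //.
by rewrite divr_ge0 // subr_ge0 ltW.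
Qed.

Section AbelianSubgroupCount.

Variables (R : realType) (gT : finGroupType) (G : {group gT}).
Hypothesis abG : abelian G.

Let N := #|G|.
Let ps := primes N.
Let I : finType := ('I_(size ps) * 'I_N)%type.
Let prime_of (x : I) : nat := tnth (in_tuple ps) x.1.

(** The value at [(i, k)] is the number of cyclic factors of order [p ^ k.+1],
    [p] being the [i]-th prime divisor of [#|G|]: each invariant factor [d]
    contributes one cyclic factor of order [p ^ logn p d]. *)
Definition type_multiplicities (H : {group gT}) : {ffun I -> 'I_N.+1} :=
  [ffun x : I => inord
    (count [pred d | logn (prime_of x) d == x.2.+1] (abelian_type H))].

Let prime_ofP x : prime (prime_of x).
Proof. by have := mem_tnth x.1 (in_tuple ps); rewrite mem_primes => /and3P[]. Qed.

Let N0 : (0 < N)%N. Proof. exact: cardG_gt0. Qed.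

Let typeP (H : {group gT}) d : H \subset G -> d \in abelian_type H ->
  (1 < d)%N /\ (d %| N)%N.
Proof.
move=> sHG dH; split; first by have /allP := abelian_type_gt1 H; apply.
apply: dvdn_trans (cardSg sHG).
rewrite -(prod_abelian_type _ _ (abelianS sHG abG)).
by rewrite (big_rem d) //= dvdn_mulr.
Qed.

Lemma type_multiplicitiesE (H : {group gT}) x : H \subset G ->
  type_multiplicities H x =
    count [pred d | logn (prime_of x) d == x.2.+1] (abelian_type H) :> nat.
Proof.
move=> sHG; rewrite ffunE inordK // ltnS; apply: leq_trans (count_size _ _) _.
apply: leq_trans (subset_leq_card sHG).
rewrite -(prod_abelian_type _ _ (abelianS sHG abG)).
apply: ltnW; have := abelian_type_gt1 H.
elim: (abelian_type H) => [|d s IHs] /=; first by rewrite big_nil.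
move=> /andP[d1 /IHs {}IHs]; rewrite big_cons; nia.
Qed.

(** The left-hand side is the logarithm of [#|H|], written through the prime
    factorisations of its invariant factors. *)
Lemma type_multiplicities_sum_leq (H : {group gT}) : H \subset G ->
  \sum_(x : I) (x.2.+1%:R * ln (prime_of x)%:R) * (type_multiplicities H x)%:R
    <= ln N%:R :> R.
Proof.
move=> sHG; have abH := abelianS sHG abG.
under eq_bigr => x _ do 
  rewrite type_multiplicitiesE // -sum1_count big_mkcond natr_sum mulr_sumr.
rewrite exchange_big /=.
apply: (@le_trans _ _ (ln #|H|%:R)); last first.
  by rewrite ler_ln ?posrE ?ltr0n ?cardG_gt0 // ler_nat subset_leq_card.
rewrite -(prod_abelian_type _ _ abH) ln_prod_nat; last first.
  by apply: sub_all (abelian_type_gt1 H) => d /= /ltnW.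
rewrite big_seq [leRHS]big_seq; apply: ler_sum => d dH.
have [d1 dN] := typeP _ _ sHG dH.
apply: le_trans (@sum_logn_ln_leq R ps d (ltnW d1) (primes_uniq _) _); last first.
  by apply/allP => p; rewrite mem_primes => /and3P[].
rewrite (big_tnth _ _ ps) -(pair_bigA _ (fun (i : 'I_(size ps)) (k : 'I_N) =>
  k.+1%:R * ln (tnth (in_tuple ps) i)%:R *
    (if logn (tnth (in_tuple ps) i) d == k.+1 then 1%N else 0%N)%:R)) /=.
apply: ler_sum => i _; set p := tnth _ _.
have p_pr : prime p.
  by have := mem_tnth i (in_tuple ps); rewrite mem_primes => /and3P[].
have lnp : 0 <= ln p%:R :> R by rewrite ln_ge0 // ler1n prime_gt0.
(* At most one term is nonzero, and it equals logn p d * ln p. *)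
have [[k0 pk0]|nk] := pselect (exists k : 'I_N, logn p d = k.+1).
  rewrite (bigD1 k0) //= pk0 eqxx big1 ?addr0 => [|k kk0].
    by rewrite mulr1.
  by rewrite eqSS eq_sym (inj_eq (@ord_inj N)) (negPf kk0) mulr0.
rewrite big1 ?mulr_ge0 // => k _; case: eqP => [pk|]; last by rewrite mulr0.
by case: nk; exists k.
Qed.

(** Pairs [(p, k)] that are not indexed have multiplicity 0 in every subgroup,
    because the invariant factors divide [#|G|]. *)
Lemma type_multiplicities_inj (H K : {group gT}) : H \subset G -> K \subset G ->
  type_multiplicities H = type_multiplicities K -> H \isog K.
Proof.
move=> sHG sKG HK; rewrite eq_abelian_type_isog ?(abelianS _ abG) //; apply/eqP.
apply: divisor_chain_inj; rewrite ?abelian_type_dvdn_sorted ?abelian_type_gt1 //.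
move=> p k p_pr; case: k => // k _.
have [/andP[pN kN]|pk] := boolP ((p \in ps) && (k < N)%N).
  have pi : (index p ps < size ps)%N by rewrite index_mem.
  have := congr1 (fun f : {ffun I -> 'I_N.+1} =>
    val (f (Ordinal pi, Ordinal kN))) HK.
  by rewrite /= !type_multiplicitiesE // /prime_of /= (tnth_nth 0%N) /= nth_index.
have count0 (L : {group gT}) : L \subset G ->
    count [pred d | logn p d == k.+1] (abelian_type L) = 0%N.
  move=> sLG; apply/eqP; rewrite -leqn0 leqNgt -has_count; apply/hasPn => d dL /=.
  have [d1 dN] := typeP _ _ sLG dL; apply: contra pk => /eqP pk.
  have : (0 < logn p d)%N by rewrite pk.
  rewrite logn_gt0 !mem_primes p_pr N0 /= => /andP[_ pd].
  rewrite (dvdn_trans pd dN) /=.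
  rewrite (leq_trans _ (dvdn_leq N0 dN)) // -pk.
  apply: leq_trans (dvdn_leq (ltnW d1) (pfactor_dvdnn p d)).
  by rewrite ltnW // ltn_expl // prime_gt1.
by rewrite !count0.
Qed.

(** Rankin's bound for the multiplicities, where a factor of order [p ^ k] has
    weight [k * ln p] and the total weight is at most [ln #|G|]. *)
Lemma ln_iso_classes_leq (s : R) : 0 < s ->
  ln #|equivalence_partition (fun H K : {group gT} => H \isog K) (subgroups G)|%:R
    <= s * ln N%:R +
       \sum_(p <- ps) expR (- (s * ln p%:R)) / (1 - expR (- (s * ln p%:R))) ^+ 2.
Proof.
move=> s0; pose w (x : I) : R := x.2.+1%:R * ln (prime_of x)%:R.
have lnp0 x : 0 < ln (prime_of x)%:R :> R by rewrite ln_gt0 // ltr1n prime_gt1.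
have w0 x : 0 < w x by rewrite mulr_gt0.
have part0 : (0 <
    #|equivalence_partition (fun H K : {group gT} => H \isog K) (subgroups G)|)%N.
  by apply: leq_trans (exp2_primes_leq_iso_classes _ _ abG); rewrite expn_gt0.
rewrite -ler_expR lnK ?posrE ?ltr0n //.
pose B := [set f : {ffun I -> 'I_N.+1} | \sum_x w x * (f x)%:R <= ln N%:R]%SET.
apply: (@le_trans _ _ #|B|%:R).
  rewrite ler_nat.
  apply: (@card_equivalence_partition_leq _ _ _ _ _ type_multiplicities).
  - exact: isog_equivalence_rel.
  - by move=> H; rewrite !inE => sHG; exact: type_multiplicities_sum_leq.
  - by move=> H K; rewrite !inE => sHG sKG; exact: type_multiplicities_inj.
apply: le_trans (card_weighted_sum_leq _ _ _ _ _ _ s0 w0) _.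
rewrite ler_expR lerD2l.
pose F (i : 'I_(size ps)) (k : 'I_N) : R :=
  let e := expR (- (s * (k.+1%:R * ln (tnth (in_tuple ps) i)%:R))) in e / (1 - e).
rewrite [leRHS](big_tnth _ _ ps) -(pair_bigA _ F) /=.
apply: ler_sum => i _; rewrite /F.
under eq_bigr => k _ do rewrite mulrCA.
apply: sum_expR_geometric_leq; rewrite mulr_gt0 //.
exact: (lnp0 (i, Ordinal N0)).
Qed.

End AbelianSubgroupCount.

(** * Estimating the sum over primes *)

Lemma half_le_ln2 (R : realType) : 1 / 2 <= ln 2 :> R.
Proof.
rewrite -ler_expR lnK ?posrE //.
have := expR_ge1Dx (- (1 / 2) : R); rewrite expRN => h.
rewrite -[leLHS]invrK invf_ple ?posrE ?invr_gt0 ?expR_gt0 //; lra.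
Qed.

Lemma ln2_le1 (R : realType) : ln 2 <= 1 :> R.
Proof.
have := @ln_sublinear R 2 ltac:(lra).
by have := @le_ln1Dx R 1 ltac:(lra); lra.
Qed.

(** The left-hand side equals [(e - 1) ^- 2 + (e - 1)^-1] with [e = expR u], and
    [e - 1 >= u >= v]. *)
Lemma expR_geometric_le_inv (R : realType) (u v : R) : 0 < v -> v <= u ->
  expR (- u) / (1 - expR (- u)) ^+ 2 <= v ^- 2 + v^-1.
Proof.
move=> v0 vu; have u0 : 0 < u by lra.
have e0 := expR_gt0 u; have eu := expR_ge1Dx u.
have -> : expR (- u) / (1 - expR (- u)) ^+ 2 = expR u / (expR u - 1) ^+ 2.
  by rewrite expRN; field; apply/andP; split; lra.
have e1u : 0 < expR u - 1 by lra.
apply: (@le_trans _ _ (u ^- 2 + u^-1)); last first.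
  by apply: lerD; rewrite lef_pV2 ?posrE ?exprn_gt0 // ler_pXn2r ?nnegrE // ltW.
have -> : expR u / (expR u - 1) ^+ 2 = (expR u - 1) ^- 2 + (expR u - 1)^-1.
  by field; lra.
have e1ge : u <= expR u - 1 by lra.
by apply: lerD; rewrite lef_pV2 ?posrE ?exprn_gt0 // ler_pXn2r ?nnegrE // ltW.
Qed.

Lemma expR_geometric_le_4_9 (R : realType) (u : R) : 4 <= expR u ->
  expR (- u) / (1 - expR (- u)) ^+ 2 <= 4 / 9.
Proof.
move=> u4; have e0 := expR_gt0 u; rewrite expRN.
have -> : (expR u)^-1 / (1 - (expR u)^-1) ^+ 2 = expR u / (expR u - 1) ^+ 2.
  by field; apply/andP; split; lra.
have e1 : 0 < (expR u - 1) ^+ 2 by rewrite exprn_gt0 //; lra.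
rewrite ler_pdivrMr // expr2.
nra.
Qed.

Lemma count_leq_real (R : realType) (s : seq nat) (z : R) :
  uniq s -> all (ltn 0) s -> 0 <= z -> (count [pred p | p%:R <= z] s)%:R <= z.
Proof.
move=> us s0 z0; rewrite -truncn_ge_nat // -size_filter.
rewrite -[leqRHS](size_iota 1); apply: uniq_leq_size; first exact: filter_uniq.
move=> p; rewrite mem_filter mem_iota /= -truncn_ge_nat //.
move=> /andP[pz /(allP s0)] /=.
by rewrite add1n ltnS pz => ->.
Qed.

(** At most [z] primes are [<= z], and [s * ln 2] bounds [s * ln p] from below for
    each of them. A prime [p > z] contributes at most
    [4 / 9 <= 4 / 9 * (ln p / ln z)], and the logarithms of the primes dividing
    [N] add up to at most [ln N]. *)
Lemma sum_primes_geometric_leq (R : realType) (N : nat) (s z : R) :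
  (0 < N)%N -> 0 < s -> 1 < z -> 4 <= expR (s * ln z) ->
  \sum_(p <- primes N) expR (- (s * ln p%:R)) / (1 - expR (- (s * ln p%:R))) ^+ 2
    <= z * ((s * ln 2) ^- 2 + (s * ln 2)^-1) + 4 / 9 * (ln N%:R / ln z).
Proof.
move=> N0 s0 z1 z4; have lnz0 : 0 < ln z by exact: ln_gt0.
have v0 : 0 < s * ln 2 by rewrite mulr_gt0 // ln_gt0 //; lra.
set C := (_ ^- 2 + _ : R).
have C0 : 0 <= C by apply: addr_ge0; rewrite invr_ge0 ?exprn_ge0 // ltW.
have prP p : p \in primes N -> prime p by rewrite mem_primes => /and3P[].
apply: (@le_trans _ _ (\sum_(p <- primes N)
    (C * (p%:R <= z)%R%:R + 4 / 9 * (ln p%:R / ln z)))).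
  rewrite big_seq [leRHS]big_seq; apply: ler_sum => p /prP p_pr.
  have p2 : 2 <= p%:R :> R by rewrite ler_nat prime_gt1.
  have lnp0 : 0 <= ln p%:R :> R by rewrite ln_ge0 //; lra.
  have [pz|zp] := leP p%:R z.
    rewrite mulr1 -[leLHS]addr0; apply: lerD; last first.
      by apply: mulr_ge0; [lra | rewrite divr_ge0 // ltW].
    apply: expR_geometric_le_inv => //.
    by rewrite ler_pM2l // ler_ln ?posrE //; lra.
  rewrite mulr0 add0r.
  have lnzp : ln z <= ln p%:R by rewrite ler_ln ?posrE //; lra.
  apply: (@le_trans _ _ (4 / 9)).
    apply: expR_geometric_le_4_9; apply: le_trans z4 _.
    by rewrite ler_expR ler_pM2l.
  by rewrite ler_peMr // ?ler_pdivlMr ?mul1r //; lra.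
rewrite big_split /= -!mulr_sumr [z * C]mulrC lerD //.
  rewrite ler_wpM2l // -natr_sum.
  rewrite (_ : (\sum_(p <- primes N) _)%N =
      count [pred p | p%:R <= z] (primes N)).
    apply: count_leq_real; rewrite ?primes_uniq //; last lra.
    by apply/allP => p /prP; exact: prime_gt0.
  by rewrite -sum1_count [RHS]big_mkcond /=; apply: eq_bigr => p _; case: ifP.
rewrite ler_wpM2l ?divr_ge0 // -mulr_suml ler_pM2r ?invr_gt0 //.
apply: (@le_trans _ _ (\sum_(p <- primes N) (logn p N)%:R * ln p%:R : R)).
  rewrite big_seq [leRHS]big_seq; apply: ler_sum => p pN.
  rewrite ler_peMl // ?ln_ge0 // ler1n ?logn_gt0 // prime_gt0 //; exact: prP.
by apply: sum_logn_ln_leq; rewrite ?primes_uniq //; apply/allP => p; exact: prP.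
Qed.

(** * The two bounds for the maximal order *)

(** Here [l] stands for [ln (ln x)]. The cubic hypothesis says that
    [z * l ^ 2], with [z = expR (9 / 10 * l)], is small against
    [expR l / l]. *)
Lemma ln_num_iso_subgroups_leq (R : realType) (n : nat) (l : R) :
  (0 < n)%N -> 1 <= l -> 30 * l ^+ 3 <= expR (1 / 10 * l) -> ln n%:R <= expR l ->
  ln (num_iso_subgroups n)%:R <= 12 / 5 * (expR l / l) :> R.
Proof.
move=> n0 l1 l_big nl; have l0 : 0 < l by lra.
have N0 : (0 < #|units_Zp n|)%N by exact: cardG_gt0.
have NL : ln #|units_Zp n|%:R <= expR l.
  apply: le_trans nl; rewrite ler_ln ?posrE ?ltr0n // ler_nat card_units_Zp //.
  rewrite totient_count_coprime -[leqRHS]subn0 -[leqRHS]muln1 -sum_nat_const_nat.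
  by apply: leq_sum => i _; exact: leq_b1.
(* With this s, s * ln z = 8 / 5 and expR (8 / 5) >= (6 / 5) ^+ 8 >= 4. *)
pose s : R := 16 / 9 / l; have s0 : 0 < s by rewrite divr_gt0 //; lra.
pose z : R := expR (9 / 10 * l).
have lnz : ln z = 9 / 10 * l by rewrite expRK.
have sz : s * ln z = 8%:R * (1 / 5) by rewrite lnz /s; field; lra.
have z1 : 1 < z by rewrite expR_gt1; lra.
have z4 : 4 <= expR (s * ln z).
  rewrite sz expRM_natl; have := expR_ge1Dx (1 / 5 : R); set e := expR _ => he.
  apply: (@le_trans _ _ ((6 / 5) ^+ 8)); first lra.
  by rewrite ler_pXn2r ?nnegrE //; lra.
apply: le_trans (ln_iso_classes_leq _ _ _ (units_Zp_abelian _) _ s0) _.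
apply: le_trans (lerD (lexx _) (sum_primes_geometric_leq _ _ _ _ N0 s0 z1 z4)) _.
set L := ln _ in NL *.
have sL : s * L <= 16 / 9 * (expR l / l).
  have -> : 16 / 9 * (expR l / l) = s * expR l by rewrite /s; field; lra.
  by rewrite ler_pM2l.
have Lz : L / ln z <= 10 / 9 * (expR l / l).
  have -> : 10 / 9 * (expR l / l) = expR l / ln z by rewrite lnz; field; lra.
  by rewrite ler_pM2r // invr_gt0 lnz mulr_gt0 //; lra.
suff : z * ((s * ln 2) ^- 2 + (s * ln 2)^-1) <= 1 / 10 * (expR l / l).
  by have : 0 <= expR l / l by [rewrite divr_ge0 ?expR_ge0 ?ltW]; lra.
have v0 : 0 < 8 / 9 / l by rewrite divr_gt0 //; lra.
have vs : 8 / 9 / l <= s * ln 2.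
  have -> : 8 / 9 / l = s * (1 / 2) by rewrite /s; field; lra.
  by rewrite ler_pM2l // half_le_ln2.
have C3 : (s * ln 2) ^- 2 + (s * ln 2)^-1 <= 3 * l ^+ 2.
  apply: (@le_trans _ _ ((8 / 9 / l) ^- 2 + (8 / 9 / l)^-1)).
    have sl0 : 0 < s * ln 2 by lra.
    by apply: lerD; rewrite lef_pV2 ?posrE ?exprn_gt0 // ler_pXn2r ?nnegrE // ltW.
  have -> : (8 / 9 / l) ^- 2 + (8 / 9 / l)^-1 = 81 / 64 * l ^+ 2 + 9 / 8 * l.
    by field; lra.
  by nra.
apply: le_trans (ler_wpM2l (expR_ge0 _) C3) _.
have -> : 1 / 10 * (expR l / l) = z * (1 / 10 * (expR (1 / 10 * l) / l)).
  have -> : expR l = z * expR (1 / 10 * l) by rewrite -expRD; congr expR; lra.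
  by ring.
rewrite ler_pM2l ?expR_gt0 // [leRHS]mulrA ler_pdivlMr //; lra.
Qed.

Lemma cube_le_expR (R : realType) (k e l : R) : 0 < e -> 0 <= l ->
  k * 24 / e ^+ 4 <= l -> k * l ^+ 3 <= expR (e * l).
Proof.
move=> e0 l0 kl; have := @expR_ge1Dxn R (e * l) 3 ltac:(nra); apply: le_trans.
rewrite (_ : 4`!%:R = 24) // -[leLHS]add0r; apply: lerD => //.
have -> : (e * l) ^+ 4 / 24 = l * (e ^+ 4 / 24) * l ^+ 3 by field.
rewrite ler_wpM2r ?exprn_ge0 //; move: kl; rewrite ler_pdivrMr ?exprn_gt0 //; lra.
Qed.

Lemma max_log_iso_subgroups_leq (R : realType) (x l : R) :
  1 <= l -> 30 * l ^+ 3 <= expR (1 / 10 * l) -> x = expR (expR l) ->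
  max_log_iso_subgroups x <= 12 / 5 * (expR l / l).
Proof.
move=> l1 l_big xE; have x0 : 0 < x by rewrite xE expR_gt0.
rewrite /max_log_iso_subgroups big_nat_cond; apply: bigmax_le => [|n].
  by rewrite mulr_ge0 ?divr_ge0 ?expR_ge0 //; lra.
rewrite andbT ltnS => /andP[n0 nx].
apply: ln_num_iso_subgroups_leq => //.
rewrite -[leRHS]expRK -xE ler_ln ?posrE ?ltr0n //.
by rewrite -truncn_ge_nat // ltW.
Qed.

(** The witness is the square of ['C(2 * m, m)], where [m] is the largest integer
    with [16 ^ m <= x]. *)
Lemma max_log_iso_subgroups_geq (R : realType) (x l : R) :
  20 <= expR l -> x = expR (expR l) -> 0 < l ->
  ln 2 / 5 * (expR l / l) <= max_log_iso_subgroups x.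
Proof.
move=> L20 xE l0; have x0 : 0 < x by rewrite xE expR_gt0.
set L := expR l in L20 xE *; have ln20 : 0 < ln 2 :> R by rewrite ln_gt0 //; lra.
have h2 := half_le_ln2 R; have h1 := ln2_le1 R.
pose m := Num.truncn (L / (4 * ln 2)).
have /andP[mL Lm] : m%:R <= L / (4 * ln 2) < m.+1%:R.
  by apply: truncn_itv; rewrite divr_ge0 ?mulr_ge0 //; lra.
have ln24 : 0 < 4 * ln 2 :> R by rewrite mulr_gt0.
move: mL Lm; rewrite ler_pdivlMr // ltr_pdivrMr // => mL Lm.
have m0 : (0 < m)%N by rewrite lt0n; apply/eqP => m00; move: Lm; rewrite m00; lra.
have m20 : (0 < 2 * m)%N by rewrite muln_gt0.
pose N := 'C(2 * m, m); have N0 : (0 < N)%N by rewrite bin_gt0 leq_pmull.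
have Nm : N%:R <= 4%:R ^+ m :> R by rewrite -natrX ler_nat central_bin_leq_exp4.
have ln4 : ln 4%:R = 2 * ln 2 :> R.
  by rewrite -[4%N]/(2 ^ 2)%N natrX lnXn // mulr_natl.
have lnN : ln N%:R <= m%:R * (2 * ln 2) :> R.
  apply: (@le_trans _ _ (ln (4%:R ^+ m))).
    by rewrite ler_ln ?posrE ?ltr0n ?exprn_gt0.
  by rewrite lnXn // ln4 -[leLHS]mulr_natl.
have n_le_x : (N ^ 2)%:R <= x.
  rewrite -[leLHS]lnK ?posrE ?ltr0n ?expn_gt0 ?N0 // xE.
  rewrite ler_expR natrX lnXn ?ltr0n //.
  by move: lnN mL; clear; lra.
set w := size (primes N).
have w_ge : m%:R * ln 2 <= w%:R * l.
  apply: (@le_trans _ _ (ln N%:R)).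
    rewrite mulr_natl -lnXn // ler_ln ?posrE ?ltr0n ?exprn_gt0 //.
    by rewrite -natrX ler_nat exp2_leq_central_bin.
  apply: (@le_trans _ _ (ln ((2 * m)%:R ^+ w))).
    rewrite ler_ln ?posrE ?ltr0n ?exprn_gt0 ?ltr0n //.
    by rewrite -natrX ler_nat central_bin_leq_exp_primes.
  rewrite lnXn ?ltr0n //.
  rewrite -[leLHS]mulr_natl ler_wpM2l //.
  rewrite -[leRHS]expRK ler_ln ?posrE ?expR_gt0 ?ltr0n //.
  have : 0 <= m%:R * (ln 2 - 1 / 2) :> R by rewrite mulr_ge0 // subr_ge0.
  by move: mL; rewrite natrM -/L; clear; lra.
apply: (@le_trans _ _ (ln (num_iso_subgroups (N ^ 2))%:R : R)); last first.
  rewrite /max_log_iso_subgroups.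
  apply: (@le_bigmax_seq _ _ _ _ 0 (N ^ 2)%N xpredT
    (fun n => ln (num_iso_subgroups n)%:R)) => //.
  by rewrite mem_index_iota expn_gt0 N0 ltnS truncn_ge_nat // ltW.
apply: (@le_trans _ _ (ln (2%:R ^+ w) : R)).
  rewrite lnXn // -[leRHS]mulr_natr.
  have -> : ln 2 / 5 * (L / l) = ln 2 * (L / (5 * l)) by field; rewrite gt_eqF.
  rewrite ler_pM2l // ler_pdivrMr ?mulr_gt0 //.
  by move: Lm h1 w_ge L20; rewrite -natr1; clear; lra.
have := exp2_primes_leq_num_iso_subgroups_sqr _ N0; rewrite -/w => w_le.
rewrite ler_ln ?posrE ?exprn_gt0 ?ltr0n ?(leq_trans _ w_le) ?expn_gt0 //.
by rewrite -natrX ler_nat.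
Qed.

Lemma twelve_fifths_le_pi_sqrt (R : realType) :
  12 / 5 <= pi * Num.sqrt (2 / 3) :> R.
Proof.
have s45 : 4 / 5 <= Num.sqrt (2 / 3) :> R.
  have -> : 4 / 5 = Num.sqrt ((4 / 5) ^+ 2) :> R.
    by rewrite sqrtr_sqr ger0_norm //; lra.
  by rewrite ler_sqrt; lra.
by have := pi_ge3 R; nra.
Qed.

Theorem theorem1p6 (R : realType) :
  @max_log_iso_subgroups R
    \is 'Theta_(nbhs +oo) (fun x : R => ln x / ln (ln x)) /\
  exists E1 E2 : {O_(nbhs +oo) (fun x : R => ln x / ln (ln x) ^+ 2)},
    \forall x \near +oo,
      ln 2 / 5 * (ln x / ln (ln x)) + E1 x <= max_log_iso_subgroups x /\
      max_log_iso_subgroups x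
        <= pi * Num.sqrt (2 / 3) * (ln x / ln (ln x)) + E2 x.
Proof.
(* Beyond A both bounds apply: 20 serves the lower one, the other summand makes
   the cube of ln (ln x) small in the upper one. *)
pose A : R := 20 + 30 * 24 / (1 / 10) ^+ 4.
have A20 : 20 <= A by rewrite lerDl divr_ge0 ?exprn_ge0 //; lra.
have bounds : \forall x \near +oo, [/\ 0 < ln (x : R) / ln (ln x),
    ln 2 / 5 * (ln x / ln (ln x)) <= max_log_iso_subgroups x &
    max_log_iso_subgroups x <= 12 / 5 * (ln x / ln (ln x))].
  apply: filterS (nbhs_pinfty_ge (num_real (expR (expR A)))) => x xA.
  have x0 : 0 < x by apply: lt_le_trans xA; exact: expR_gt0.
  have LA : expR A <= ln x by rewrite -[leLHS]expRK ler_ln ?posrE ?expR_gt0.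
  have L0 : 0 < ln x by apply: lt_le_trans LA; exact: expR_gt0.
  have lA : A <= ln (ln x) by rewrite -[leLHS]expRK ler_ln ?posrE ?expR_gt0.
  have l20 : 20 <= ln (ln x) by exact: le_trans lA.
  have l0 : 0 < ln (ln x) by exact: lt_le_trans l20.
  have LE : ln x = expR (ln (ln x)) by rewrite lnK.
  have xE : x = expR (expR (ln (ln x))) by rewrite -LE lnK.
  have L20 : 20 <= expR (ln (ln x)).
    by apply: le_trans l20 _; apply: le_trans (expR_ge1Dx _); rewrite lerDr.
  have cube : 30 * ln (ln x) ^+ 3 <= expR (1 / 10 * ln (ln x)).
    apply: cube_le_expR => //; first exact: ltW.
    by apply: le_trans lA; rewrite lerDr.
  split; first exact: divr_gt0.
  - by rewrite [X in _ * (X / _)]LE; exact: max_log_iso_subgroups_geq.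
  - rewrite [X in _ * (X / _)]LE; apply: max_log_iso_subgroups_leq => //.
    by apply: le_trans l20; rewrite ler1n.
have ln20 : 0 < ln 2 :> R by rewrite ln_gt0 // ltr1n.
split.
  rewrite qualifE; apply/asboolP; exists (ln 2 / 5, 12 / 5) => /=.
    by rewrite !divr_gt0.
  near=> x; have [f0 lo up] : [/\ 0 < ln x / ln (ln x),
    ln 2 / 5 * (ln x / ln (ln x)) <= max_log_iso_subgroups x &
    max_log_iso_subgroups x <= 12 / 5 * (ln x / ln (ln x))] by near: x.
  rewrite (gtr0_norm f0) ger0_norm //; apply: le_trans lo.
  by apply: mulr_ge0; [apply: divr_ge0 => //|]; exact: ltW.
pose zeroO : {O_(nbhs +oo) (fun x : R => ln x / ln (ln x) ^+ 2)} :=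
  BigO (asboolT (@bigO0_subproof _ _ R _ _ _
    (@filter_filter _ _ proper_pinfty_nbhs))).
exists zeroO, zeroO; near=> x.
have [f0 lo up] : [/\ 0 < ln x / ln (ln x),
    ln 2 / 5 * (ln x / ln (ln x)) <= max_log_iso_subgroups x &
    max_log_iso_subgroups x <= 12 / 5 * (ln x / ln (ln x))] by near: x.
rewrite /= !addr0; split=> //; apply: le_trans up _.
by rewrite ler_pM2r // twelve_fifths_le_pi_sqrt.
Unshelve. all: by end_near.
Qed.
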